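(* Let $G=\mathbb{Z}_{n_1}\oplus\cdots\oplus\mathbb{Z}_{n_k}$ be a finite abelian group of order $n=n_1\cdots n_k$, enumerated as $G=\{a_0,\ldots,a_{n-1}\}$ with $a_0=0$, and let $S\subseteq G\setminus\{0\}$ with $S=-S$. Let $a,b$ be two distinct vertices of $\mathrm{Cay}(G,S)$, let $\lambda_r=\sum_{y\in S}\chi_r(y)$ for $0\le r\le n-1$, and let $X_1=\{r: 0\le r\le n-1,\ \chi_r(b-a)=1\}$. Then $\mathrm{Cay}(G,S)$ exhibits PGFR between $a$ and $b$ if and only if both of the following hold: (i) $n$ is even and $b-a$ is an element of order two; (ii) for arbitrary integers $m_0,m_1,\ldots,m_{n-1}$, the two relations $\sum_{r=0}^{n-1}m_r\lambda_r=0$ and $\sum_{r=0}^{n-1}m_r=0$ imply $\sum_{r\in X_1}m_r\neq\pm1$.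
   Context: For a finite abelian group $G$ (written additively) and $S\subseteq G\setminus\{0\}$ with $S=-S$, the Cayley graph $\mathrm{Cay}(G,S)$ has vertex set $G$, two distinct vertices $a,b$ being adjacent iff $b-a\in S$. For $a_r=(g_{1r},\ldots,g_{kr})\in G$, the character $\chi_r$ is defined by $\chi_r(a_\ell)=\prod_{j=1}^k\omega_{n_j}^{g_{jr}g_{j\ell}}$ where $\omega_{n_j}=\exp(2\pi\mathbf{i}/n_j)$; the numbers $\lambda_r$ are the eigenvalues of $\mathrm{Cay}(G,S)$. For a graph $\Gamma$ with adjacency matrix $A$, the transition matrix is $H(t)=\exp(-\mathbf{i}tA)$, $t\in\mathbb{R}$, and $\mathbf{e}_v$ denotes the standard basis vector of vertex $v$. $\Gamma$ exhibits pretty good fractional revival (PGFR) between distinct vertices $a$ and $b$ if there is a sequence of real numbers $\{t_k\}$ with $\lim_{k\to\infty}H(t_k)\mathbf{e}_a=\alpha\mathbf{e}_a+\beta\mathbf{e}_b$ for some $\alpha,\beta\in\mathbb{C}$ with $\beta\neq0$ and $|\alpha|^2+|\beta|^2=1$. *)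

(* Defs.v *)
From HB Require Import structures.
From mathcomp Require Import all_boot all_order all_algebra all_fingroup.
From mathcomp Require Import complex.
From mathcomp Require Import all_classical all_reals all_analysis.

Set Implicit Arguments.
Unset Strict Implicit.
Unset Printing Implicit Defensive.

Import Order.TTheory GRing.Theory Num.Theory.
Import numFieldNormedType.Exports.

Local Open Scope classical_set_scope.
Local Open Scope ring_scope.
Local Open Scope complex_scope.

(* The topology of [R[i]] is the one induced by its norm, as for every        *)
(* [numFieldType]; these instances let type inference find it on [R[i]].      *)
HB.instance Definition _ (R : rcfType) :=
  PseudoPointedMetric.copy R[i] (R[i] : numFieldType)^o.
HB.instance Definition _ (R : rcfType) :=
  NormedModule.copy R[i] (R[i] : numFieldType)^o.

Section DirectSum.
Variables (k : nat) (n : 'I_k -> nat).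

(* [Z_{n_0} (+) ... (+) Z_{n_{k-1}}] for positive [n_j]. The cyclic group of  *)
(* order [m > 0] is ['I_m.-1.+1] with addition modulo [m], not ['Z_m], which  *)
(* has two elements when [m = 1].                                             *)
Definition Zsum : Type := {dffun forall j : 'I_k, 'I_(n j).-1.+1}.

HB.instance Definition _ := Finite.on Zsum.

Definition zsum_zero : Zsum := [ffun j => 0].
Definition zsum_opp (x : Zsum) : Zsum := [ffun j => - x j].
Definition zsum_add (x y : Zsum) : Zsum :=
  [ffun j => x j + y j].

Fact zsum_addA : associative zsum_add.
Proof. by move=> x y z; apply/ffunP => j; rewrite !ffunE addrA. Qed.

Fact zsum_addC : commutative zsum_add.
Proof. by move=> x y; apply/ffunP => j; rewrite !ffunE addrC. Qed.

Fact zsum_add0 : left_id zsum_zero zsum_add.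
Proof. by move=> x; apply/ffunP => j; rewrite !ffunE add0r. Qed.

Fact zsum_addN : left_inverse zsum_zero zsum_opp zsum_add.
Proof. by move=> x; apply/ffunP => j; rewrite !ffunE addNr. Qed.

HB.instance Definition _ :=
  GRing.isZmodule.Build Zsum zsum_addA zsum_addC zsum_add0 zsum_addN.
HB.instance Definition _ := [finGroupMixin of Zsum for +%R].

End DirectSum.

Definition cayley (G : finZmodType) (S : {set G}) : rel G :=
  fun x y => (x != y) && (y - x \in S).

Section Complex.
Variable R : realType.

Definition cexp (z : R[i]) : R[i] := limn (series (fun p : nat => z ^+ p / p`!%:R)).

Definition omega (m : nat) : R[i] :=
  cexp (2 * (pi : R)%:C * 'i / m%:R).

Definition zsum_char (k : nat) (n : 'I_k -> nat) (g x : Zsum n) : R[i] :=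
  \prod_(j < k) omega (n j) ^+ (g j * x j)%N.

Definition mexp (m : nat) (X : 'M[R[i]]_m) : 'M[R[i]]_m :=
  limn (series (fun p : nat => (p`!%:R)^-1 *: X ^+ p)).

(* A finite graph is given by its adjacency relation on a finite type; the    *)
(* rows and columns of its matrices are indexed through [enum_rank].          *)
Section Graph.
Variables (T : finType) (e : rel T).

Definition adjacency : 'M[R[i]]_#|T| :=
  \matrix_(x, y) (e (enum_val x) (enum_val y))%:R.

Definition transition (t : R) : 'M[R[i]]_#|T| :=
  mexp (- ('i * t%:C) *: adjacency).

Definition vertex_vec (v : T) : 'cV[R[i]]_#|T| := delta_mx (enum_rank v) 0.

Definition PGFR (u v : T) : Prop :=
  u != v /\
  exists (t : nat -> R) (alpha beta : R[i]),
    [/\ beta != 0, `|alpha| ^+ 2 + `|beta| ^+ 2 = 1 &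
      transition (t p) *m vertex_vec u @[p --> \oo] -->
        alpha *: vertex_vec u + beta *: vertex_vec v].

End Graph.
End Complex.

(* Main.v *)
Require Import Defs.
From HB Require Import structures.
From mathcomp Require Import all_boot all_order all_algebra all_fingroup.
From mathcomp Require Import cyclic complex.
From mathcomp Require Import all_classical all_reals all_analysis.
From mathcomp Require Import ring lra zify.

(* The characters diagonalize the adjacency matrix, so H(t_p) e_u tends to
   alpha e_u + beta e_v iff exp(-i t_p l_g) tends to alpha + beta chi_g(v - u)
   for every g. Since l_g = l_(-g), such limits force chi_g(v - u) to be real for
   all g, i.e. 2 (v - u) = 0, and then PGFR means that the exp(-i t_p l_r) tend to
   a unimodular x for r in X_1 and to another unimodular y outside X_1. A relation
   sum m_r l_r = 0 with sum m_r = 0 gives (x / y) ^ (sum_(X_1) m_r) = 1, which is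
   impossible when this sum is 1 or -1.

   Conversely, under (ii) the sums over X_1 of all relations lie in q Z for some
   q >= 2. Put w_r = exp(2 i pi / q) on X_1 and w_r = 1 elsewhere. By Bohr's proof
   of Kronecker's theorem, the supremum over t of |sum_r w_r exp(i t l_r)| is the
   number n of terms: expanding an N-th power, monomials with equal frequencies
   have equal phases, hence n ^ N <= (N + 1) ^ n sup ^ N. Along a sequence of
   times approaching the supremum all terms align, and compactness of the circle
   gives them a common limit. *)

Import Order.TTheory GRing.Theory Num.Theory.
Import numFieldNormedType.Exports.

Set Implicit Arguments.
Unset Strict Implicit.
Unset Printing Implicit Defensive.

Local Open Scope classical_set_scope.
Local Open Scope ring_scope.
Import Normc.
Local Open Scope complex_scope.

(** * The complex exponential on the imaginary axis *)

Section Cis.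
Variable R : realType.
Implicit Types x y t : R.

Definition cis x : R[i] := cos x +i* sin x.

Lemma cis0 : cis 0 = 1.
Proof. by rewrite /cis cos0 sin0. Qed.

Lemma cisD x y : cis (x + y) = cis x * cis y.
Proof.
rewrite /cis cosD sinD; apply/eqP; rewrite eq_complex /= eqxx /=.
by apply/eqP; ring.
Qed.

Lemma norm_cis x : `|cis x| = 1.
Proof. by rewrite normc_def /= cos2Dsin2 sqrtr1. Qed.

Lemma cis_neq0 x : cis x != 0.
Proof. by rewrite -normr_eq0 norm_cis oner_eq0. Qed.

Lemma cisV x : cis (- x) = (cis x)^-1.
Proof.
by apply: (mulfI (cis_neq0 x)); rewrite -cisD subrr cis0 mulfV // cis_neq0.
Qed.

Lemma cis_sum (I : Type) (r : seq I) (P : pred I) (F : I -> R) :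
  cis (\sum_(i <- r | P i) F i) = \prod_(i <- r | P i) cis (F i).
Proof. exact: (big_morph _ cisD cis0). Qed.

Lemma cisMn x m : cis (x *+ m) = cis x ^+ m.
Proof. by elim: m => [|m IH]; rewrite ?cis0 // mulrS exprS cisD IH. Qed.

Lemma cispi : cis pi = -1.
Proof. by rewrite /cis cospi sinpi; apply/eqP; rewrite eq_complex /= oppr0 !eqxx. Qed.

Lemma cis2pi : cis (pi *+ 2) = 1.
Proof. by rewrite cisMn cispi sqrrN expr1n. Qed.

(** Half-angle formula: cos x = 1 - 2 sin(x / 2) ^ 2, and sin(x / 2) > 0 because 0 < x / 2 < pi. *)
Lemma cis_neq1 x : 0 < x < pi *+ 2 -> cis x != 1.
Proof.
move=> /andP[x0 x2]; have -> : x = x / 2 *+ 2 by lra.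
rewrite /cis cos_mulr2n eq_complex /= negb_and.
have s0 : 0 < sin (x / 2) by apply: sin_gt0_pi; lra.
by have := cos2Dsin2 (x / 2) => H; apply/orP; left; apply/eqP; nra.
Qed.

Lemma cvg_complex (f g : nat -> R) x y :
  f p @[p --> \oo] --> x -> g p @[p --> \oo] --> y ->
  (f p +i* g p : R[i]) @[p --> \oo] --> (x +i* y : R[i]).
Proof.
move=> /cvgrPdist_lt fx /cvgrPdist_lt gy; apply/cvgrPdist_lt => -[e e'].
(* Positivity in [R[i]] forces the imaginary part of the radius to vanish, so the radius is a
   positive real. *)
rewrite ltcE /= => /andP[/eqP -> e0].
have e2 : 0 < e / 2 by lra.
near=> p.
have H1 : `|x - f p| < e / 2 by near: p; apply: fx.
have H2 : `|y - g p| < e / 2 by near: p; apply: gy.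
rewrite normc_def ltcR /=.
apply: (@le_lt_trans _ _ (`|x - f p| + `|y - g p|)); last by lra.
rewrite -[leRHS]ger0_norm ?addr_ge0 // -sqrtr_sqr ler_wsqrtr //.
have := normr_ge0 (x - f p); have := normr_ge0 (y - g p).
rewrite -[_ ^+ 2 as X in X + _]real_normK ?num_real //.
rewrite -[(_ - _) ^+ 2 as X in _ + X <= _]real_normK ?num_real //.
by nra.
Unshelve. all: by end_near.
Qed.

Lemma cvg_cis_series x :
  series (fun p : nat => ('i * x%:C) ^+ p / p`!%:R) @ \oo --> cis x.
Proof.
have -> : series (fun p : nat => ('i * x%:C) ^+ p / p`!%:R) =
  (fun p => series (cos_coeff x) p +i* series (sin_coeff x) p).
  apply/funext => p; rewrite /series /=.
  elim: p => [|p IH]; first by rewrite !big_geq.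
  rewrite !big_nat_recr //= IH.
  have -> : ('i * x%:C) ^+ p / p`!%:R = cos_coeff x p +i* sin_coeff x p.
    rewrite exprMn -rmorphXn -(rmorph_nat (real_complex R)) -fmorphV -mulrA -rmorphM /=.
    rewrite /cos_coeff /sin_coeff /=.
    (* Even powers of i are real and odd ones imaginary, which splits the term into its cosine and
       sine coefficients. *)
    have -> : 'i ^+ p = (-1) ^+ p./2 * 'i ^+ odd p :> R[i].
      rewrite -{1}(odd_double_half p) addnC exprD -mul2n exprM; congr (_ ^+ _ * _).
      by rewrite -(@sqr_i R).
    have -> : (-1 : R[i]) ^+ p./2 = ((-1) ^+ p./2)%:C by rewrite rmorphXn rmorphN rmorph1.
    have -> : p.-1./2 = (p./2 - ~~ odd p)%N by lia.
    have -> : forall m : nat, (-1 : R) ^ m = (-1) ^+ m by [].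
    case: (odd p) => /=; apply/eqP; rewrite eq_complex /=; apply/andP; split; apply/eqP;
      rewrite ?expr0 ?expr1 /=; rewrite ?subn0; ring.
  by [].
apply: cvg_complex.
  by rewrite cos.unlock; exact: is_cvg_series_cos_coeff.
by rewrite sin.unlock; exact: is_cvg_series_sin_coeff.
Qed.

Lemma cexp_cis x : cexp ('i * x%:C) = cis x.
Proof. by apply: cvg_lim; [exact: norm_hausdorff | exact: cvg_cis_series]. Qed.

End Cis.

(** * Matrix exponential of a diagonalizable matrix *)

Lemma cvg_eq (T : topologicalType) (f f' : nat -> T) (l l' : T) :
  f =1 f' -> l = l' -> f p @[p --> \oo] --> l -> f' p @[p --> \oo] --> l'.
Proof. by move=> /funext -> ->. Qed.

Section MatrixLimits.
Variable R : realType.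
Local Notation C := R[i].

Lemma cvg_mxP m n (f : nat -> 'M[C]_(m, n)) (M : 'M[C]_(m, n)) :
  f p @[p --> \oo] --> M <->
  forall i j, f p i j @[p --> \oo] --> M i j.
Proof.
split=> [fM i j A MA | fM A [P MP sPA]].
  suff : nbhs M [set N : 'M[C]_(m, n) | A (N i j)] by move/fM.
  (* Basic matrix neighborhoods are products of neighborhoods of the entries; only the entry (i, j)
     is constrained. *)
  exists (fun i' j' => if (i', j') == (i, j) then A else setT).
    by move=> i' j'; case: eqP => [[-> ->] //|_]; exact: filterT.
  by move=> N /(_ i j); rewrite eqxx.
near=> p; apply: sPA; near: p; apply: filter_forall => i; apply: filter_forall => j.
exact: fM (MP i j).
Unshelve. all: by end_near.
Qed.

Lemma cvg_mulmxr m n q (f : nat -> 'M[C]_(m, n)) (M : 'M[C]_(m, n)) (A : 'M[C]_(n, q)) :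
  f p @[p --> \oo] --> M -> f p *m A @[p --> \oo] --> M *m A.
Proof.
move=> /cvg_mxP fM; apply/cvg_mxP => i j.
rewrite mxE; under eq_cvg do rewrite mxE.
by apply: cvg_big => [|k _]; [exact: add_continuous|]; apply: cvgMr_tmp; exact: fM.
Qed.

Lemma cvg_mulmxl m n q (f : nat -> 'M[C]_(n, q)) (M : 'M[C]_(n, q)) (A : 'M[C]_(m, n)) :
  f p @[p --> \oo] --> M -> A *m f p @[p --> \oo] --> A *m M.
Proof.
move=> /cvg_mxP fM; apply/cvg_mxP => i j.
rewrite mxE; under eq_cvg do rewrite mxE.
by apply: cvg_big => [|k _]; [exact: add_continuous|]; apply: cvgMl_tmp; exact: fM.
Qed.

(** The relation P X = D P passes to powers, so the partial sums of exp(X) are conjugates of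
    diagonal matrices of scalar partial sums, and conjugation is continuous. *)
Lemma mexp_diagonalizable m (P X : 'M[C]_m) (d c : 'rV[C]_m) :
  P \in unitmx -> P *m X = diag_mx d *m P ->
  (forall i, series (fun p => d 0 i ^+ p / p`!%:R) @ \oo --> c 0 i) ->
  P *m mexp X = diag_mx c *m P.
Proof.
move=> Pu PX dc.
have PXp p : P *m X ^+ p = diag_mx (\row_j d 0 j ^+ p) *m P.
  elim: p => [|p IH].
    rewrite expr0 mulmx1 -[LHS]mul1mx; congr (_ *m _).
    by apply/matrixP => i j; rewrite !mxE expr0.
  rewrite exprSr mulmxA IH -mulmxA PX mulmxA; congr (_ *m _).
  apply/matrixP => i j; rewrite mul_diag_mx !mxE exprSr.
  by case: eqP => [->|_]; rewrite ?mulr1n // mulr0n mulr0.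
have -> : mexp X = invmx P *m (diag_mx c *m P); last by rewrite mulKVmx.
apply: cvg_lim; first exact: norm_hausdorff.
have -> : series (fun p : nat => (p`!%:R)^-1 *: X ^+ p) = (fun N : nat =>
    invmx P *m (diag_mx (\row_j series (fun p => d 0 j ^+ p / p`!%:R) N) *m P)).
  apply/funext => N; rewrite -[LHS](mulKmx Pu); congr (_ *m _).
  rewrite /series /= mulmx_sumr; apply/matrixP => i j; rewrite summxE mul_diag_mx !mxE mulr_suml.
  apply: eq_bigr => p _; rewrite -scalemxAr PXp mul_diag_mx !mxE; ring.
apply: cvg_mulmxl; apply: cvg_mulmxr; apply/cvg_mxP => i j; rewrite !mxE.
under eq_cvg do rewrite !mxE.
by case: eqP => _; [exact: dc | exact: cvg_cst].
Qed.

End MatrixLimits.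

(** * Characters *)

Section OmegaPowers.
Variable R : realType.

Lemma omegaE m : omega R m = cis (pi *+ 2 / m%:R).
Proof.
rewrite /omega -cexp_cis; congr cexp.
rewrite rmorphM fmorphV !rmorph_nat rmorphMn /= -mulr_natl; ring.
Qed.

Lemma omega_expE m p : omega R m ^+ p = cis (pi *+ 2 / m%:R *+ p).
Proof. by rewrite omegaE cisMn. Qed.

Lemma norm_omega m : `|omega R m| = 1.
Proof. by rewrite omegaE norm_cis. Qed.

Lemma omega_order m : (0 < m)%N -> omega R m ^+ m = 1.
Proof.
move=> m0; rewrite omega_expE -mulr_natr divfK ?cis2pi //.
by rewrite pnatr_eq0 -lt0n.
Qed.

Lemma omega_exp_neq1 m p : (0 < p < m)%N -> omega R m ^+ p != 1.
Proof.
move=> /andP[p0 pm]; rewrite omega_expE cis_neq1 //.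
have pi0 := @pi_gt0 R; have pi2 : 0 < pi *+ 2 :> R by lra.
have m0 : 0 < m%:R :> R by rewrite ltr0n; lia.
rewrite -[_ *+ p]mulr_natr; apply/andP; split.
  by rewrite mulr_gt0 ?divr_gt0 // ltr0n.
by rewrite mulrAC ltr_pdivrMr // ltr_pM2l ?ltr_nat.
Qed.

Lemma omega_exp_mod m p : (0 < m)%N -> omega R m ^+ (p %% m) = omega R m ^+ p.
Proof. by move=> m0; rewrite {2}(divn_eq p m) exprD mulnC exprM omega_order // expr1n mul1r. Qed.

End OmegaPowers.

Section Characters.
Variables (R : realType) (k : nat) (n : 'I_k -> nat).
Hypothesis n_gt0 : forall j, (0 < n j)%N.
Implicit Types g x y : Zsum n.
Local Notation chi := (zsum_char R).

Lemma card_Zsum : #|{: Zsum n}| = (\prod_(j < k) n j)%N.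
Proof.
rewrite [LHS]card_dep_ffun foldrE big_map big_enum /=.
by apply: eq_bigr => j _; rewrite card_ord prednK.
Qed.

Lemma zsum_charC g x : chi g x = chi x g.
Proof. by apply: eq_bigr => j _; rewrite mulnC. Qed.

Lemma norm_zsum_char g x : `|chi g x| = 1.
Proof. by rewrite normr_prod big1 // => j _; rewrite normrX norm_omega expr1n. Qed.

Lemma zsum_char_neq0 g x : chi g x != 0.
Proof. by rewrite -normr_eq0 norm_zsum_char oner_eq0. Qed.

Lemma zsum_charD g x y : chi g (x + y) = chi g x * chi g y.
Proof.
rewrite /zsum_char -big_split /=; apply: eq_bigr => j _.
rewrite -exprD -mulnDr ![(g j * _)%N]mulnC !exprM ffunE /=.
(* Coordinates add modulo [(n j).-1.+1], which is [n j]; an [n j]-th root of unity does not see the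
   reduction. *)
congr (_ ^+ _); rewrite -[RHS]omega_exp_mod //; congr (_ ^+ (_ %% _)%N).
by rewrite prednK.
Qed.

Lemma zsum_char0 g : chi g 0 = 1.
Proof. by rewrite /zsum_char big1 // => j _; rewrite ffunE muln0. Qed.

Lemma zsum_charN g x : chi g (- x) = (chi g x)^-1.
Proof.
apply: (mulfI (zsum_char_neq0 g x)).
by rewrite -zsum_charD subrr zsum_char0 mulfV ?zsum_char_neq0.
Qed.

(** The inverse of a number of modulus one is its conjugate. *)
Lemma zsum_charNJ g x : chi g (- x) = (chi g x)^*.
Proof.
rewrite zsum_charN; apply: (mulfI (zsum_char_neq0 g x)).
rewrite mulfV ?zsum_char_neq0 // -[1](expr1n _ 2) -(norm_zsum_char g x).
rewrite -add_Re2_Im2; case: (chi g x) => a b.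
by apply/eqP; rewrite eq_complex /=; apply/andP; split; apply/eqP; ring.
Qed.

Lemma zsum_charNl g x : chi (- g) x = chi g (- x).
Proof. by rewrite zsum_charC !zsum_charN zsum_charC. Qed.

(** Characters separate points: the one indexed by the j-th unit vector takes the value omega ^ (x
    j), which is 1 only when x j = 0. *)
Lemma zsum_char_eq1 x : (forall g, chi g x = 1) -> x = 0.
Proof.
move=> chi1; apply/ffunP => j; apply/val_inj; rewrite ffunE /=.
(* A trivial factor has no unit vector, but its only element is 0. *)
have [nj1|nj1] := leqP (n j) 1.
  by have := ltn_ord (x j); have := n_gt0 j; lia.
pose g : Zsum n := [ffun i => inord (i == j)].
have := chi1 g; rewrite /zsum_char (bigD1 j) //= big1 => [|i ij]; last first.
  by rewrite ffunE (negbTE ij) inordK ?mul0n.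
rewrite mulr1 ffunE eqxx inordK ?mul1n; last by lia.
have := ltn_ord (x j); case: (posnP (x j)) => // x0 xn /eqP.
by rewrite (negbTE (omega_exp_neq1 _ _)) // x0; lia.
Qed.

Lemma sum_zsum_char x : \sum_g chi g x = (x == 0)%:R *+ #|{: Zsum n}|.
Proof.
case: eqP => [->|x0] /=.
  rewrite (eq_bigr (fun=> 1)) => [|g _]; last exact: zsum_char0.
  by rewrite sumr_const.
rewrite mul0rn.
have [g g1] : exists g, chi g x != 1.
  apply: contrapT => H; apply: x0; apply: zsum_char_eq1 => g.
  by apply/eqP; apply: contrapT => /negP g1; apply: H; exists g.
(* Translating the index by g shows that the sum is fixed by multiplication by a number other than
   1, so it vanishes. *)
have : chi g x * \sum_h chi h x = \sum_h chi h x.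
  rewrite mulr_sumr [RHS](reindex_inj (addrI g)) /=; apply: eq_bigr => h _.
  by rewrite ![chi _ x]zsum_charC zsum_charD.
move/eqP; rewrite -subr_eq0 -{2}[\sum_h _]mul1r -mulrBl mulf_eq0 subr_eq0.
by rewrite (negbTE g1) => /eqP.
Qed.

End Characters.

(** * Spectrum of a Cayley graph *)

Section Spectrum.
Variables (R : realType) (k : nat) (n : 'I_k -> nat).
Hypothesis n_gt0 : forall j, (0 < n j)%N.
Variable S : {set Zsum n}.
Hypothesis S_nz : 0 \notin S.
Hypothesis S_opp : [set - y | y in S]%SET = S.
Implicit Types g x y : Zsum n.
Local Notation chi := (zsum_char R).

(** Since S = -S, the sum equals its conjugate, so the real part loses nothing and provides a
    frequency in [R]. *)
Definition cayley_eigenvalue g : R := complex.Re (\sum_(y in S) chi g y).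
Local Notation l := cayley_eigenvalue.

Lemma mem_oppS y : (- y \in S) = (y \in S).
Proof. by rewrite -{1}S_opp mem_imset //; exact: oppr_inj. Qed.

Lemma sum_charN g : \sum_(y in S) chi g (- y) = \sum_(y in S) chi g y.
Proof.
rewrite [RHS](reindex_inj oppr_inj) /=.
by apply: eq_bigl => y; rewrite mem_oppS.
Qed.

Lemma cayley_eigenvalueE g : \sum_(y in S) chi g y = (l g)%:C.
Proof.
rewrite /l; set s := \sum_(y in S) _.
have : s^* = s.
  rewrite -[RHS]sum_charN rmorph_sum /=.
  by apply: eq_bigr => y _; rewrite zsum_charNJ.
case: s => a b [] bN; congr (_ +i* _).
by lra.
Qed.

Lemma cayley_eigenvalueN g : l (- g) = l g.
Proof.
rewrite /l -sum_charN; congr complex.Re; apply: eq_bigr => y _.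
by rewrite zsum_charNl // opprK.
Qed.

(** The character table; its rows are left eigenvectors of the adjacency matrix. *)
Definition char_mx : 'M[R[i]]_#|{: Zsum n}| :=
  \matrix_(i, j) chi (enum_val i) (enum_val j).

(** By orthogonality of characters, the conjugate table divided by the order of the group is an
    inverse. *)
Lemma char_mx_unit : char_mx \in unitmx.
Proof.
pose Q : 'M[R[i]]_#|{: Zsum n}| :=
  #|{: Zsum n}|%:R^-1 *: \matrix_(i, j) chi (enum_val i) (- enum_val j).
suff /mulmx1_unit[] : char_mx *m Q = 1%:M by [].
apply/matrixP => i j; rewrite -scalemxAr !mxE.
under eq_bigr do rewrite !mxE zsum_charC -zsum_charD //.
rewrite (reindex _ (onW_bij _ (@enum_rank_bij _))) /=.
under eq_bigr do rewrite enum_rankK.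
rewrite sum_zsum_char // subr_eq0 (inj_eq enum_val_inj).
case: eqP => _; last by rewrite mul0rn mulr0.
rewrite mulVf // pnatr_eq0 -lt0n; apply/card_gt0P; exists 0.
by [].
Qed.

Lemma char_mx_adjacency :
  char_mx *m adjacency R (cayley S) =
  diag_mx (\row_i (l (enum_val i))%:C) *m char_mx.
Proof.
apply/matrixP => i j; rewrite mul_diag_mx !mxE -cayley_eigenvalueE.
set g := enum_val i; set x := enum_val j.
rewrite (reindex _ (onW_bij _ (@enum_rank_bij _))) /=.
under eq_bigr do rewrite !mxE enum_rankK -/g -/x.
(* The neighbors of x are the x - y with y in S, and chi_g(x - y) = chi_g(x) chi_g(-y). *)
rewrite -sum_charN mulr_suml [LHS](reindex_inj (addrI x)) /= [LHS](reindex_inj oppr_inj) /=.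
rewrite [RHS]big_mkcond /=; apply: eq_bigr => y _.
rewrite /cayley opprB addrCA subrr addr0 zsum_charD // mulrC.
rewrite -subr_eq0 addrAC subrr add0r oppr_eq0.
case: ifP => yS; rewrite ?andbF ?mul0r // andbT.
have -> : y != 0 by apply: contraTneq yS => ->.
by rewrite mul1r mulrC.
Qed.

Lemma char_mx_transition t :
  char_mx *m transition (cayley S) t =
  diag_mx (\row_i cis (- (t * l (enum_val i)))) *m char_mx.
Proof.
pose d : 'rV[R[i]]_#|{: Zsum n}| := - ('i * t%:C) *: \row_i (l (enum_val i))%:C.
apply: (@mexp_diagonalizable _ _ _ _ d); first exact: char_mx_unit.
  rewrite -scalemxAr char_mx_adjacency scalemxAl; congr (_ *m _).
  by apply/matrixP => i j; rewrite !mxE mulrnAr.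
move=> i; rewrite !mxE.
have -> : - ('i * t%:C) * (l (enum_val i))%:C = 'i * (- (t * l (enum_val i)))%:C :> R[i].
  by rewrite rmorphN rmorphM /=; ring.
exact: cvg_cis_series.
Qed.

Lemma char_mx_vertex_vec x i : (char_mx *m vertex_vec R x) i 0 = chi (enum_val i) x.
Proof.
rewrite mxE (bigD1 (enum_rank x)) //= big1 => [|j jx]; rewrite !mxE.
  by rewrite !eqxx enum_rankK mulr1 addr0.
by rewrite (negbTE jx) mulr0.
Qed.

(** Multiplication by the invertible [char_mx] preserves and reflects limits. Both sides then carry
    the nonzero factor chi_g(u) in coordinate g, which cancels. *)
Lemma transition_cvgP (t : nat -> R) (alpha beta : R[i]) u v :
  transition (cayley S) (t p) *m vertex_vec R u @[p --> \oo] -->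
    alpha *: vertex_vec R u + beta *: vertex_vec R v <->
  forall g, cis (- (t p * l g)) @[p --> \oo] --> alpha + beta * chi g (v - u).
Proof.
have lhsE p i : (char_mx *m (transition (cayley S) (t p) *m vertex_vec R u)) i 0 =
    cis (- (t p * l (enum_val i))) * chi (enum_val i) u.
  by rewrite mulmxA char_mx_transition -mulmxA mul_diag_mx !mxE
             -char_mx_vertex_vec !mxE.
have rhsE i : (char_mx *m (alpha *: vertex_vec R u + beta *: vertex_vec R v)) i 0 =
    (alpha + beta * chi (enum_val i) (v - u)) * chi (enum_val i) u.
  rewrite mulmxDr -!scalemxAr -[_ *: _ + _]/(_ + _) mxE [X in X + _]mxE [X in _ + X]mxE.
  by rewrite !char_mx_vertex_vec mulrDl -mulrA -zsum_charD // subrK.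
split=> [H g | H].
  have /cvg_mxP/(_ (enum_rank g) 0) := cvg_mulmxl (A := char_mx) H.
  rewrite rhsE; under eq_cvg do rewrite lhsE.
  rewrite enum_rankK => H'.
  apply: (cvg_eq _ _ (cvgMr_tmp (b := (chi g u)^-1) H')) => [p|].
    by rewrite mulfK ?zsum_char_neq0.
  by rewrite mulfK ?zsum_char_neq0.
suff H' : char_mx *m (transition (cayley S) (t p) *m vertex_vec R u) @[p --> \oo] -->
    char_mx *m (alpha *: vertex_vec R u + beta *: vertex_vec R v).
  apply: (cvg_eq _ _ (cvg_mulmxl (A := invmx char_mx) H')) => [p|];
  by rewrite mulKmx ?char_mx_unit.
apply/cvg_mxP => i j; rewrite ord1 rhsE.
by under eq_cvg do rewrite lhsE; apply: cvgMr_tmp; exact: H.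
Qed.

End Spectrum.

(** * Bohr's lemma *)

Section Bohr.
Variable R : realType.
Local Notation C := R[i].

(** Exponential growth beats polynomial growth: if a > b > 0, then (a / b) ^ N = exp(N L) with L =
    ln(a / b), which exceeds the term of degree d + 1 of its series. *)
Lemma exp_le_poly (a b : R) d : 0 <= b ->
  (forall N, a ^+ N <= N.+1%:R ^+ d * b ^+ N) -> a <= b.
Proof.
move=> b0 H; rewrite leNgt; apply/negP => ba.
have [b00|bn0] := eqVneq b 0.
  by have := H 1%N; rewrite !expr1 b00 mulr0 leNgt -b00 ba.
have {b0 bn0}b0 : 0 < b by rewrite lt_neqAle eq_sym bn0.
have ab1 : 1 < a / b by rewrite ltr_pdivlMr // mul1r.
pose L := ln (a / b); have L0 : 0 < L by rewrite ln_gt0.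
have LE : expR L = a / b by rewrite lnK // posrE (lt_trans ltr01).
(* N > c is exactly the condition (2 N) ^ d < (N L) ^ (d + 1) / (d + 1)!, and N + 1 <= 2 N. *)
pose c := 2 ^+ d * d.+1`!%:R / L ^+ d.+1.
have c0 : 0 < c by rewrite divr_gt0 ?mulr_gt0 ?exprn_gt0 // ltr0n fact_gt0.
pose N := (Num.trunc c).+1; have cN : c < N%:R by exact: truncnS_gt.
have N0 : 0 < N%:R :> R by rewrite ltr0n.
have := H N; rewrite -ler_pdivrMr ?exprn_gt0 // -expr_div_n -LE -expRM_natl leNgt => /negP[].
have NL0 : 0 <= N%:R * L by rewrite mulr_ge0 ?ltW.
apply: lt_le_trans (expR_ge1Dxn d NL0).
apply: (@le_lt_trans _ _ ((2 * N%:R) ^+ d)).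
  by rewrite lerXn2r ?nnegrE // -natrM ler_nat; lia.
apply: (@le_lt_trans _ _ ((N%:R * L) ^+ d.+1 / d.+1`!%:R)); last by rewrite ltrDr.
rewrite ler_pdivlMr ?ltr0n ?fact_gt0 // !exprMn exprSr -[leRHS]mulrA mulrAC.
by rewrite mulrC ler_pM2l ?exprn_gt0 // -ler_pdivrMr ?exprn_gt0 // ltW.
Qed.

(* Averaging F(t) and cis(-h mu0) F(t + h), where cis(h (nu - mu0)) = -1, kills
   the frequency nu, leaves the coefficient of mu0 unchanged and does not
   increase the bound. *)
Lemma norm_coef_le (I : finType) (mu : I -> R) (mu0 : R) (B : C) (c : I -> C) :
  (forall t, `|\sum_i c i * cis (t * mu i)| <= B) ->
  `|\sum_(i | mu i == mu0) c i| <= B.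
Proof.
(* Induction on a list holding every frequency other than [mu0] with a nonzero coefficient; [c]
   varies, since each averaging changes the coefficients. *)
have : forall i, mu i != mu0 -> c i != 0 -> mu i \in codom mu.
  by move=> i _ _; apply: codom_f.
elim: (codom mu) c => [|nu s IH] c cs FB.
  have := FB 0; rewrite (bigID (fun i => mu i == mu0)) /= [X in _ + X]big1 => [|i imu].
    rewrite addr0; congr (`|_| <= _); apply: eq_bigr => i _.
    by rewrite mul0r cis0 mulr1.
  have [->|ci] := eqVneq (c i) 0; first by rewrite mul0r.
  by have := cs i imu ci.
have [nu0|nu_mu0] := eqVneq nu mu0.
  apply: IH FB => i imu ci; have := cs i imu ci.
  by rewrite inE nu0 (negbTE imu).
pose h := pi / (nu - mu0).
pose c' i := c i * ((1 + cis (h * (mu i - mu0))) / 2).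
have -> : \sum_(i | mu i == mu0) c i = \sum_(i | mu i == mu0) c' i.
  apply: eq_bigr => i /eqP imu; rewrite /c' imu subrr mulr0 cis0.
  by rewrite -[1 + 1]/(2%:R) divff ?mulr1 // pnatr_eq0.
apply: IH => [i imu | t].
  rewrite /c' mulf_eq0 negb_or => /andP[ci Hi].
  have := cs i imu ci; rewrite inE => /orP[/eqP inu|//].
  move: Hi; rewrite inu /h divfK ?subr_eq0 // cispi subrr mul0r.
  by rewrite eqxx.
have -> : \sum_i c' i * cis (t * mu i) =
  (\sum_i c i * cis (t * mu i) + cis (- (h * mu0)) * \sum_i c i * cis ((t + h) * mu i)) / 2.
  rewrite mulr_sumr -big_split mulr_suml /=; apply: eq_bigr => i _.
  rewrite /c' mulrBr cisD [(t + h) * _]mulrDl [cis (_ + h * _)]cisD.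
  ring.
rewrite normrM normfV normr_nat ler_pdivrMr // mulr_natr mulr2n.
apply: (le_trans (ler_normD _ _)); rewrite lerD //.
by rewrite normrM norm_cis mul1r.
Qed.

(* Two monomials of the N-th power of the sum having the same frequency have the
   same phase, so the coefficient of each frequency is as large as the number of
   monomials contributing to it, and there are at most (N + 1) ^ #|I| frequencies. *)
Lemma bohr_sup (I : finType) (w : I -> C) (mu : I -> R) (B : R) :
  (forall i, `|w i| = 1) ->
  (forall c c' : I -> nat, (\sum_i c i = \sum_i c' i)%N ->
     \sum_i (c i)%:R * mu i = \sum_i (c' i)%:R * mu i ->
     \prod_i w i ^+ c i = \prod_i w i ^+ c' i) ->
  (forall t, `|\sum_i w i * cis (t * mu i)| <= B%:C) ->
  #|I|%:R <= B.
Proof.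
move=> w1 wP FB.
have B0 : 0 <= B by rewrite -ler0c; apply: le_trans (FB 0).
apply: (@exp_le_poly _ _ #|I|) => // N.
(* Each [f] picks one term per factor of the N-th power: [W f] is the phase of the monomial, [M f]
   its frequency and [cnt f] its exponent vector. *)
pose W (f : {ffun 'I_N -> I}) := \prod_j w (f j).
pose M (f : {ffun 'I_N -> I}) := \sum_j mu (f j).
pose cnt (f : {ffun 'I_N -> I}) i := #|[pred j | f j == i]|.
have cntN f i : (cnt f i < N.+1)%N.
  by rewrite ltnS -[leqRHS]card_ord max_card.
have sum_cnt f : (\sum_i cnt f i = N)%N.
  rewrite -[RHS]card_ord -sum1_card (partition_big f predT) //=.
  by apply: eq_bigr => i _; rewrite sum1_card.
have McntE f : M f = \sum_i (cnt f i)%:R * mu i.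
  rewrite /M (partition_big f predT) //=; apply: eq_bigr => i _.
  rewrite (eq_bigr (fun=> mu i)) => [|j /eqP -> //].
  by rewrite sumr_const mulr_natl.
have WcntE f : W f = \prod_i w i ^+ cnt f i.
  rewrite /W (partition_big f predT) //=; apply: eq_bigr => i _.
  rewrite (eq_bigr (fun=> w i)) => [|j /eqP -> //].
  by rewrite prodr_const.
have FN t : \sum_f W f * cis (t * M f) = (\sum_i w i * cis (t * mu i)) ^+ N.
  rewrite -[in RHS](card_ord N) -prodr_const bigA_distr_bigA /=.
  apply: eq_bigr => f _; rewrite big_split /=; congr (_ * _).
  by rewrite /M mulr_sumr cis_sum.
have classB f0 : #|[pred f | M f == M f0]|%:R <= B ^+ N.
  have : forall t, `|\sum_f W f * cis (t * M f)| <= (B ^+ N)%:C.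
    by move=> t; rewrite FN normrX rmorphXn /= lerXn2r ?nnegrE // ler0c.
  move=> /(@norm_coef_le _ M (M f0) _ W).
  rewrite (eq_bigr (fun=> W f0)) => [|f /eqP Mf]; last first.
    by rewrite !WcntE; apply: wP; rewrite ?sum_cnt // -!McntE.
  rewrite sumr_const normrMn /W normr_prod big1 => [|//].
  by rewrite -(rmorph_nat (real_complex R)) lecR.
(* Monomials are sorted by exponent vector. Each class has a single frequency, hence at most B ^ N
   members. *)
pose K (f : {ffun 'I_N -> I}) : {ffun I -> 'I_N.+1} := [ffun i => inord (cnt f i)].
rewrite -[leLHS]natrX.
have -> : (#|I| ^ N = \sum_ka #|[pred f | K f == ka]|)%N.
  rewrite -[in LHS](card_ord N) -card_ffun -sum1_card (partition_big K predT) //=.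
  by apply: eq_bigr => i _; rewrite sum1_card.
rewrite natr_sum; apply: (@le_trans _ _ (\sum_(ka : {ffun I -> 'I_N.+1}) B ^+ N)).
  apply: ler_sum => ka _.
  case: (pickP [pred f | K f == ka]) => [f0 /eqP Kf0 | K0]; last first.
    by rewrite (eq_card0 K0) exprn_ge0.
  apply: le_trans (classB f0); rewrite ler_nat; apply: subset_leq_card; apply/fintype.subsetP => f.
  rewrite !inE => /eqP Kf; rewrite !McntE; apply/eqP/eq_bigr => i _; congr (_%:R * _).
  have := congr1 (fun g : {ffun I -> 'I_N.+1} => val (g i)) (etrans Kf (esym Kf0)).
  by rewrite /K !ffunE /= !inordK.
by rewrite sumr_const card_ffun card_ord -[leLHS]mulr_natl natrX.
Qed.

End Bohr.

(** * Alignment of phases and compactness of the circle *)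

Section Alignment.
Variable R : realType.
Local Notation C := R[i].

Lemma parallelogram (x y : C) :
  `|x + y| ^+ 2 + `|x - y| ^+ 2 = (`|x| ^+ 2 + `|y| ^+ 2) *+ 2.
Proof.
rewrite -!add_Re2_Im2; case: x y => [a b] [c d] /=.
by rewrite -!rmorphD -rmorphMn /=; congr (_%:C); ring.
Qed.

Lemma normc_ge0 (z : C) : 0 <= normc z.
Proof. by rewrite -ler0c; exact: normr_ge0 z. Qed.

(** When the whole sum has modulus above #|I| - d, any two of its unit terms have a sum of modulus
    above 2 - d, and the parallelogram law makes their difference small. *)
Lemma aligned_time (I : finType) (w : I -> C) (mu : I -> R) :
  (forall i, `|w i| = 1) ->
  (forall c c' : I -> nat, (\sum_i c i = \sum_i c' i)%N ->
     \sum_i (c i)%:R * mu i = \sum_i (c' i)%:R * mu i ->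
     \prod_i w i ^+ c i = \prod_i w i ^+ c' i) ->
  forall e : R, 0 < e -> exists t, forall i j,
    `|w i * cis (t * mu i) - w j * cis (t * mu j)| < e%:C.
Proof.
move=> w1 wP e e0.
pose u t i := w i * cis (t * mu i).
have u1 t i : normc (u t i) = 1.
  by apply: complexI; rewrite -[LHS]/(`|u t i|) /u normrM w1 norm_cis mulr1.
(* The squared difference is below 4 - (2 - d) ^ 2 <= 4 d <= e ^ 2 / 2; d <= 1 keeps 2 - d positive
   for squaring. *)
pose d := Num.min 1 (e ^+ 2 / 8).
have d0 : 0 < d by rewrite lt_min ltr01 divr_gt0 ?exprn_gt0.
have d1 : d <= 1 by rewrite ge_min lexx.
have de : d <= e ^+ 2 / 8 by rewrite ge_min lexx orbT.
have [t Ft] : exists t, #|I|%:R - d < normc (\sum_i u t i).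
  apply: contrapT => H.
  suff : #|I|%:R <= #|I|%:R - d by lra.
  apply: (bohr_sup w1 wP) => t; rewrite lecR leNgt; apply/negP => Ht.
  by apply: H; exists t.
exists t => i j; rewrite -/(u t i) -/(u t j) ltcR.
have [->|ij] := eqVneq i j; first by rewrite subrr normc0.
have sum_ij : 2 - d < normc (u t i + u t j).
  move: Ft; rewrite (bigD1 i) //= (bigD1 j) 1?eq_sym //= addrA.
  move=> /lt_le_trans/(_ (le_normcD _ _)) Ft.
  have : normc (\sum_(l | (l != i) && (l != j)) u t l) <= #|I|%:R - 2.
    have -> : #|I|%:R - 2 = \sum_(l | (l != i) && (l != j)) 1 :> R.
      have -> : #|I|%:R = \sum_(l : I) 1 :> R by rewrite sumr_const.
      by rewrite (bigD1 i) //= (bigD1 j) 1?eq_sym //=; ring.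
    elim/big_rec2: _ => [|l y1 y2 _ IH]; first by rewrite normc0.
    by apply: (le_trans (le_normcD _ _)); rewrite u1 lerD2l.
  lra.
have P : normc (u t i + u t j) ^+ 2 + normc (u t i - u t j) ^+ 2 = (1 ^+ 2 + 1 ^+ 2) *+ 2.
  apply: complexI; rewrite rmorphD !rmorphXn [LHS]parallelogram.
  by rewrite -[`|u t i|]/(normc _)%:C -[`|u t j|]/(normc _)%:C !u1 -!rmorphXn -rmorphD -rmorphMn.
rewrite -(@ltr_pXn2r _ 2) ?nnegrE ?normc_ge0 ?(ltW e0) //.
have : (2 - d) ^+ 2 < normc (u t i + u t j) ^+ 2.
  by rewrite ltr_pXn2r ?nnegrE ?normc_ge0 //; lra.
nra.
Qed.

Lemma increasing_seq_ge (f : nat -> nat) p : increasing_seq f -> (p <= f p)%N.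
Proof.
move=> /increasing_seqP f_lt; elim: p => // p IH.
exact: leq_ltn_trans IH (f_lt p).
Qed.

Lemma cvg_subseq (T : topologicalType) (f : nat -> nat) (a : nat -> T) (l : T) :
  increasing_seq f -> a p @[p --> \oo] --> l -> a (f p) @[p --> \oo] --> l.
Proof.
move=> fi al A /al [N _ NA]; exists N => // p /= Np; apply: NA => /=.
exact: leq_trans Np (increasing_seq_ge p fi).
Qed.

(** A subsequence along which the real parts converge is refined so that the imaginary parts
    converge too. *)
Lemma bolzano_weierstrass_complex (z : nat -> C) : (forall p, `|z p| <= 1) ->
  exists2 f : nat -> nat, increasing_seq f &
    exists l : C, z (f p) @[p --> \oo] --> l.
Proof.
move=> z1.
have bnd (a : nat -> R) : (forall p, a p ^+ 2 <= 1) -> bounded_fun a.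
  move=> a1; exists 1; split; first exact: num_real.
  move=> x x1 p _ /=; apply: le_trans (ltW x1); rewrite ler_norml.
  by have := a1 p; nra.
have zE p : complex.Re (z p) ^+ 2 + complex.Im (z p) ^+ 2 <= 1.
  by rewrite -lecR add_Re2_Im2 rmorph1 expr_le1.
have [|f fi /cvg_ex[/= x fx]] := @bolzano_weierstrass R (fun p => complex.Re (z p)).
  by apply: bnd => p; have := zE p; nra.
have [|g gi /cvg_ex[/= y gy]] := @bolzano_weierstrass R (fun p => complex.Im (z (f p))).
  by apply: bnd => p; have := zE (f p); nra.
exists (f \o g); first by move=> p q /=; rewrite fi; exact: gi.
exists (x +i* y).
have -> : (fun p => z ((f \o g) p)) =
  (fun p => complex.Re (z (f (g p))) +i* complex.Im (z (f (g p)))).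
  by apply/funext => p /=; case: (z _).
apply: cvg_complex gy.
exact: (cvg_subseq gi fx).
Qed.

Lemma norm_lim_unit (z : nat -> C) (l : C) :
  (forall p, `|z p| = 1) -> z p @[p --> \oo] --> l -> `|l| = 1.
Proof.
move=> z1 zl.
have lim1 : `|z p| @[p --> \oo] --> (1 : C).
  by apply: (cvg_eq _ erefl (@cvg_cst _ (1 : C) _ \oo _)) => p; rewrite z1.
by apply: (cvg_unique _ (cvg_norm zl) lim1); exact: norm_hausdorff.
Qed.

(** Along times with alignment error 1 / (p + 1), compactness gives one chosen term a limit on a
    subsequence, and the other terms follow it. *)
Lemma aligned_limit (I : finType) (w : I -> C) (mu : I -> R) :
  (forall i, `|w i| = 1) ->
  (forall c c' : I -> nat, (\sum_i c i = \sum_i c' i)%N ->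
     \sum_i (c i)%:R * mu i = \sum_i (c' i)%:R * mu i ->
     \prod_i w i ^+ c i = \prod_i w i ^+ c' i) ->
  exists (t : nat -> R) (l : C), `|l| = 1 /\
    forall i, w i * cis (t p * mu i) @[p --> \oo] --> l.
Proof.
move=> w1 wP.
have /choice[t tP] : forall p : nat, exists t, forall i j,
    `|w i * cis (t * mu i) - w j * cis (t * mu j)| < (harmonic p)%:C.
  by move=> p; apply: (aligned_time w1 wP); rewrite invr_gt0 ltr0n.
have u1 i s : `|w i * cis (s * mu i)| = 1 by rewrite normrM w1 norm_cis mulr1.
case: (pickP (@predT I)) => [i0 _ | I0]; last first.
  by exists t, 1; split=> [|i]; [rewrite normr1 | have := I0 i].
have [|f fi [l ul]] := @bolzano_weierstrass_complex (fun p => w i0 * cis (t p * mu i0)).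
  by move=> p; rewrite u1.
exists (t \o f), l; split; first by apply: (norm_lim_unit _ ul) => p; rewrite u1.
move=> i.
suff dl : w i * cis (t (f p) * mu i) - w i0 * cis (t (f p) * mu i0) @[p --> \oo] --> (0 : C).
  by apply: (cvg_eq _ (add0r l) (cvgD dl ul)) => p; rewrite subrK.
apply/cvgr0Pnorm_lt => -[e e'].
rewrite ltcE /= => /andP[/eqP -> e0].
have /cvgrPdist_lt/(_ _ e0)[N _ NP] := @cvg_harmonic R.
exists N => // p /= Np; apply: (lt_trans (tP _ _ _)); rewrite ltcR.
have := NP (f p) (leq_trans Np (increasing_seq_ge p fi)).
by rewrite sub0r normrN ger0_norm // harmonic_ge0.
Qed.

End Alignment.

(** * Integer relations and limits with two phases *)

(** Here [D] is a subgroup of the integers, generated by its least positive element, which is not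
    1. *)
Lemma proper_int_subgroup (D : int -> Prop) :
  D 0 -> (forall x y, D x -> D y -> D (x - y)) -> ~ D 1 ->
  exists q : nat, (1 < q)%N /\ forall z, D z -> (q %| z)%Z.
Proof.
move=> D0 DB D1.
have DN x : D x -> D (- x) by move=> Dx; rewrite -sub0r; exact: DB.
have DD x y : D x -> D y -> D (x + y).
  by move=> Dx Dy; rewrite -[y]opprK; apply: DB => //; exact: DN.
have DMn x p : D x -> D (x *+ p).
  by move=> Dx; elim: p => // p IH; rewrite mulrS; exact: DD.
have DMz x p : D x -> D (x *~ p).
  by move=> Dx; case: p => p; [exact: DMn | apply: DN; exact: DMn].
have Dabs x : D x -> D (absz x).
  by move=> Dx; rewrite abszE; case: (ger0P x) => // _; exact: DN.
have [[d /andP[d0 /asboolP Dd]] | Dpos] :=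
    pselect (exists d : nat, (0 < d)%N && `[< D d >]); last first.
  (* The zero subgroup: any modulus above 1 would do. *)
  exists 2%N; split=> // z Dz; have [->|z0] := eqVneq z 0; first exact: dvdz0.
  by case: Dpos; exists `|z|%N; rewrite absz_gt0 z0; apply/asboolP; exact: Dabs.
have exD : exists d : nat, (0 < d)%N && `[< D d >] by exists d; rewrite d0; apply/asboolP.
case: (ex_minnP exD) => q /andP[q0 /asboolP Dq] q_min.
exists q; split=> [|z Dz].
  by rewrite ltn_neqAle q0 andbT; apply/eqP => q1; apply: D1; move: Dq; rewrite -q1.
(* The remainder stays in [D] and is below [q], so minimality forces it to be 0. *)
have Dmod : D (z %% q)%Z.
  by rewrite /modz mulrC -mulrzz; apply: DB => //; exact: DMz.
have mod_ge0 : 0 <= (z %% q)%Z by rewrite modz_ge0 // -lt0n.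
have mod_lt : (z %% q)%Z < q by rewrite ltz_pmod.
apply/dvdz_mod0P; apply: contrapT => /eqP mod_neq0.
have : (q <= `|(z %% q)%Z|)%N.
  by apply: q_min; rewrite absz_gt0 mod_neq0; apply/asboolP; exact: Dabs.
lia.
Qed.

Section TwoPhases.
Variable R : realType.
Local Notation C := R[i].

Lemma relation_modulus (I : finType) (mu : I -> R) (X : {set I}) :
  (forall m : I -> int, \sum_i (m i)%:~R * mu i = 0 -> \sum_i m i = 0 ->
     \sum_(i in X) m i <> 1) ->
  exists q : nat, (1 < q)%N /\
    forall m : I -> int, \sum_i (m i)%:~R * mu i = 0 -> \sum_i m i = 0 ->
     (q %| \sum_(i in X) m i)%Z.
Proof.
move=> X1.
pose D z := exists m : I -> int, [/\ \sum_i (m i)%:~R * mu i = 0, \sum_i m i = 0 &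
     \sum_(i in X) m i = z].
have [|||q [q1 qP]] := @proper_int_subgroup D.
- by exists (fun=> 0); rewrite !big1 // => i _; rewrite mul0r.
- move=> x y [m [m1 m2 m3]] [m' [m1' m2' m3']]; exists (fun i => m i - m' i); split.
  + under eq_bigr do rewrite rmorphB mulrBl.
    by rewrite sumrB m1 m1' subrr.
  + by rewrite sumrB m2 m2' subrr.
  + by rewrite sumrB m3 m3'.
- by move=> [m [m1 m2 /X1]]; apply.
by exists q; split=> // m m1 m2; apply: qP; exists m.
Qed.

Lemma two_phase_limit (I : finType) (mu : I -> R) (X : {set I}) :
  (forall m : I -> int, \sum_i (m i)%:~R * mu i = 0 -> \sum_i m i = 0 ->
     \sum_(i in X) m i <> 1) ->
  exists (t : nat -> R) (x y : C), [/\ `|x| = 1, `|y| = 1, x != y &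
    forall i, cis (t p * mu i) @[p --> \oo] --> (if i \in X then x else y)].
Proof.
move=> /relation_modulus[q [q1 qP]].
pose z := omega R q.
have z0 : z != 0 by rewrite -normr_eq0 norm_omega oner_eq0.
pose w i := if i \in X then z else 1.
have w1 i : `|w i| = 1 by rewrite /w; case: ifP; rewrite ?norm_omega ?normr1.
have prod_w (c : I -> nat) : \prod_i w i ^+ c i = z ^+ (\sum_(i in X) c i).
  rewrite -prodrXr [RHS]big_mkcond /=; apply: eq_bigr => i _.
  by rewrite /w; case: ifP; rewrite ?expr1n.
have [|t [l [l1 tl]]] := @aligned_limit R I w mu w1.
  move=> c c' cc' ccmu; rewrite !prod_w -[LHS]omega_exp_mod; last lia.
  rewrite -[RHS]omega_exp_mod; last lia.
  congr (_ ^+ _); apply/eqP; rewrite -eqz_nat -!modz_nat eqz_mod_dvd.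
  rewrite !(big_morph Posz PoszD (erefl _)) -sumrB.
  (* Two exponent vectors of equal degree and equal frequency differ by a relation, so their sums
     over [X] agree modulo [q]. *)
  apply: (qP (fun i => (c i)%:Z - (c' i)%:Z)).
    under eq_bigr do rewrite rmorphB mulrBl.
    by apply/eqP; rewrite sumrB subr_eq0; apply/eqP; exact: ccmu.
  by rewrite sumrB -!(big_morph Posz PoszD (erefl _)) cc' subrr.
exists t, (l / z), l; split.
- by rewrite normrM normfV norm_omega l1 divr1.
- exact: l1.
- rewrite -subr_eq0 -{2}[l]mulr1 -mulrBr mulf_neq0 //.
    by rewrite -normr_eq0 l1 oner_eq0.
  rewrite subr_eq0 invr_eq1; have := @omega_exp_neq1 R q 1; rewrite expr1; apply; lia.
- move=> i; have -> : (if i \in X then l / z else l) = l * (w i)^-1.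
    by rewrite /w; case: ifP; rewrite ?invr1 ?mulr1.
  apply: (cvg_eq _ erefl (cvgMr_tmp (b := (w i)^-1) (tl i))) => p.
  by rewrite mulrAC mulfV ?mul1r // -normr_eq0 w1 oner_eq0.
Qed.

Lemma cvg_exprz (z : nat -> C) (l : C) (m : int) : l != 0 ->
  z p @[p --> \oo] --> l -> z p ^ m @[p --> \oo] --> l ^ m.
Proof.
move=> l0 zl.
have zX p : z q ^+ p @[q --> \oo] --> l ^+ p.
  elim: p => [|p IH]; first exact: cvg_cst.
  rewrite exprS; under eq_cvg do rewrite exprS.
  exact: (cvgM zl IH).
case: m => p.
  exact: (cvg_eq (fun q => exprnP (z q) p) (exprnP l p) (zX p)).
have zV : (z q ^+ p.+1)^-1 @[q --> \oo] --> (l ^+ p.+1)^-1.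
  by apply: cvgV (zX p.+1); rewrite expf_neq0.
have negzE (x : C) : (x ^+ p.+1)^-1 = x ^ Negz p by [].
exact: (cvg_eq (fun q => negzE (z q)) (negzE l) zV).
Qed.

Lemma prodf_exprz (I : finType) (P : pred I) (x : C) (m : I -> int) : x != 0 ->
  \prod_(i | P i) x ^ m i = x ^ (\sum_(i | P i) m i).
Proof.
by move=> x0; apply/esym/(big_morph _ (fun a b => expfzDr a b x0)); rewrite expr0z.
Qed.

(** The product of the cis(-t mu_i) ^ m_i is 1 at every time. In the limit x ^ s y ^ s' = 1, where s
    and s' are the sums of m over X and its complement, and s' = -s. *)
Lemma phase_relation (I : finType) (mu : I -> R) (X : {set I})
    (t : nat -> R) (x y : C) (m : I -> int) :
  (forall i, cis (- (t p * mu i)) @[p --> \oo] --> (if i \in X then x else y)) ->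
  x != 0 -> y != 0 ->
  \sum_i (m i)%:~R * mu i = 0 -> \sum_i m i = 0 ->
  x ^ (\sum_(i in X) m i) = y ^ (\sum_(i in X) m i).
Proof.
move=> txy x0 y0 m_mu m0.
have lim1 : \prod_i cis (- (t p * mu i)) ^ m i @[p --> \oo] -->
    \prod_i (if i \in X then x else y) ^ m i.
  apply: cvg_big => [|i _]; first exact: mul_continuous.
  by apply: cvg_exprz; [case: ifP | exact: txy].
have cis_mu p : \prod_i cis (- (t p * mu i)) ^ m i = 1.
  have cisz s (k : int) : cis s ^ k = cis (k%:~R * s) :> C.
    case: k => k /=; first by rewrite -exprnP -cisMn mulr_natl.
    rewrite -[LHS]/((cis s ^+ k.+1)^-1) NegzE rmorphN mulNr cisV -cisMn.
    by congr (cis _)^-1; rewrite mulr_natl.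
  under eq_bigr do rewrite cisz mulrN mulrCA -mulrN.
  by rewrite -cis_sum -mulr_sumr sumrN m_mu oppr0 mulr0 cis0.
have : \prod_i (if i \in X then x else y) ^ m i = 1.
  have lim2 : \prod_i cis (- (t p * mu i)) ^ m i @[p --> \oo] --> (1 : C).
    by apply: (cvg_eq _ erefl (@cvg_cst _ (1 : C) _ \oo _)) => p; rewrite cis_mu.
  by apply: (cvg_unique _ lim1 lim2); exact: norm_hausdorff.
rewrite (bigID [in X]) /=.
rewrite (eq_bigr (fun i => x ^ m i)) => [|i ->//].
rewrite [X in _ * X = _](eq_bigr (fun i => y ^ m i)) => [|i /negbTE -> //].
rewrite (prodf_exprz _ _ x0) (prodf_exprz _ _ y0) => xy.
move: m0; rewrite (bigID [in X]) /= => /eqP; rewrite addr_eq0 => /eqP m0.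
set e := \sum_(i | i \notin X) m i in xy m0.
apply: (mulIf (expfz_neq0 e y0)); rewrite xy [in RHS]m0 -invr_expz.
by rewrite mulVf ?expfz_neq0.
Qed.

End TwoPhases.

(** * Pretty good fractional revival *)

Section Revival.
Variables (R : realType) (k : nat) (n : 'I_k -> nat).
Hypothesis n_gt0 : forall j, (0 < n j)%N.

Lemma order2_Zsum (w : Zsum n) : w != 0 -> w + w = 0 -> #[w]%g = 2%N.
Proof. by move=> w0 ww; apply: nt_prime_order. Qed.

Lemma order2_addrr (w : Zsum n) : #[w]%g = 2%N -> w + w = 0.
Proof. by move=> w2; have := expg_order w; rewrite w2. Qed.

Lemma even_card_Zsum (w : Zsum n) : #[w]%g = 2%N -> ~~ odd (\prod_(j < k) n j).
Proof.
move=> w2; have := order_dvdG (G := [group of [set: Zsum n]%G]) (finset.in_setT w).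
by rewrite cardsT /= w2 card_Zsum // dvdn2.
Qed.

(** The square of the value is chi_g(w + w) = 1. *)
Lemma char_pm1 (g w : Zsum n) : w + w = 0 ->
  zsum_char R g w = if zsum_char R g w == 1 then 1 else -1.
Proof.
move=> ww; case: eqP => // /eqP chi1; apply/eqP; rewrite -addr_eq0.
have : (zsum_char R g w - 1) * (zsum_char R g w + 1) == 0.
  by rewrite -subr_sqr expr1n expr2 -zsum_charD // ww zsum_char0 subrr.
by rewrite mulf_eq0 subr_eq0 (negbTE chi1).
Qed.

End Revival.

Unset Implicit Arguments.

Theorem theorem3p3 (R : realType) (k : nat) (n : 'I_k -> nat)
  (n_gt0 : forall j, (0 < n j)%N)
  (a : 'I_(\prod_(j < k) n j) -> Zsum n)
  (a_bij : bijective a)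
  (a0 : forall r, val r = 0%N -> a r = 0)
  (S : {set Zsum n}) (S_nz : 0 \notin S) (S_opp : [set - y | y in S]%SET = S)
  (u v : Zsum n) (u_neq_v : u != v) :
  let lambda r := \sum_(y in S) zsum_char R (a r) y in
  let X1 := [set r | zsum_char R (a r) (v - u) == 1]%SET in
  PGFR R (cayley S) u v <->
    (~~ odd (\prod_(j < k) n j) /\ #[v - u]%g = 2%N) /\
    (forall m : 'I_(\prod_(j < k) n j) -> int,
       \sum_r (m r)%:~R * lambda r = 0 -> \sum_r m r = 0 ->
       \sum_(r in X1) m r <> 1 /\ \sum_(r in X1) m r <> -1).
Proof.
move=> lambda X1; set w := v - u.
have w0 : w != 0 by rewrite subr_eq0 eq_sym.
pose mu r := cayley_eigenvalue R S (a r).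
have lambda_sum (m : 'I_(\prod_(j < k) n j) -> int) :
    \sum_r (m r)%:~R * lambda r = (\sum_r (m r)%:~R * mu r)%:C.
  rewrite rmorph_sum /=; apply: eq_bigr => r _.
  by rewrite rmorphM rmorph_int /lambda cayley_eigenvalueE.
have [a' _ a'K] := a_bij.
split=> [[_ [t [alpha [beta [beta0 ab1 /transition_cvgP tab]]]]] | [[_ w2] rel]].
  have {}tab := tab n_gt0 S_nz S_opp.
  (* The eigenvalues at g and -g agree, so the two limits coincide; as beta is nonzero, chi_g(w) =
     chi_g(-w), that is chi_g(w + w) = 1 for every g. *)
  have ww : w + w = 0.
    apply: (zsum_char_eq1 n_gt0 (R := R)) => g.
    have tabN : cis (- (t p * cayley_eigenvalue R S g)) @[p --> \oo] -->
        alpha + beta * zsum_char R (- g) w.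
      by rewrite -(cayley_eigenvalueN R n_gt0 S_opp); exact: tab.
    have /addrI/(mulfI beta0) : alpha + beta * zsum_char R g w =
        alpha + beta * zsum_char R (- g) w.
      by apply: (cvg_unique _ (tab g) tabN); exact: norm_hausdorff.
    rewrite zsum_charNl // zsum_charD // => {2}->.
    by rewrite -zsum_charD // subrr zsum_char0.
  have w2 := order2_Zsum w0 ww.
  split; first by split=> //; exact: (even_card_Zsum n_gt0 w2).
  have abE r : alpha + beta * zsum_char R (a r) w =
      if r \in X1 then alpha + beta else alpha - beta.
    by rewrite (char_pm1 R n_gt0 _ ww) inE; case: ifP => _; rewrite ?mulr1 ?mulrN1.
  have norm_ab r : `|alpha + beta * zsum_char R (a r) w| = 1.
    by apply: (norm_lim_unit _ (tab (a r))) => p; rewrite norm_cis.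
  move=> m; rewrite lambda_sum => m_mu m0.
  have {}m_mu : \sum_r (m r)%:~R * mu r = 0 by apply: complexI.
  have ab_neq0 r : (if r \in X1 then alpha + beta else alpha - beta) != 0.
    by rewrite -abE -normr_eq0 norm_ab oner_eq0.
  (* The trivial character lies in [X1], so alpha + beta is one of the unimodular limits; some
     character lies outside because w is nonzero, which handles alpha - beta. *)
  have abp : alpha + beta != 0.
    by have := ab_neq0 (a' 0); rewrite inE a'K zsum_charC zsum_char0 eqxx.
  have abm : alpha - beta != 0.
    have [g g1] : exists g, zsum_char R g w != 1.
      apply: contrapT => H; move/eqP: w0; apply; apply: (zsum_char_eq1 n_gt0 (R := R)) => g.
      by apply: contrapT => /eqP g1; apply: H; exists g.
    by have := ab_neq0 (a' g); rewrite inE a'K (negbTE g1).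
  have tabX r : cis (- (t p * mu r)) @[p --> \oo] -->
      (if r \in X1 then alpha + beta else alpha - beta).
    by rewrite -abE; exact: tab.
  have rel := phase_relation tabX abp abm m_mu m0.
  have ab_neq : alpha + beta <> alpha - beta.
    move=> /addrI/eqP; rewrite -addr_eq0 -mulr2n -mulr_natr mulf_eq0 (negbTE beta0).
    by rewrite pnatr_eq0.
  by split=> s; move: rel; rewrite s ?expr1z // => /invr_inj.
have ww := order2_addrr w2.
have [|t [x [y [x1 y1 xy txy]]]] := @two_phase_limit R _ mu X1.
  by move=> m m_mu m0; have [] := rel m; rewrite ?lambda_sum ?m_mu.
split=> //.
(* The coefficients solve alpha + beta = x and alpha - beta = y; time is reversed because the
   transition matrix has eigenvalues exp(-i t l). *)
exists (fun p => - t p), ((x + y) / 2), ((x - y) / 2); split.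
- by rewrite mulf_neq0 ?subr_eq0 // invr_eq0 pnatr_eq0.
- rewrite !normrM normfV normr_nat !exprMn -mulrDl parallelogram x1 y1.
  by field.
apply/(transition_cvgP n_gt0 S_nz S_opp) => g.
rewrite -(a'K g).
apply: (cvg_eq _ _ (txy (a' g))) => [p|].
  by rewrite mulNr opprK.
rewrite (char_pm1 R n_gt0 _ ww) inE; case: ifP => _.
  by field.
by field.
Qed.
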